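(* For all integers $n\geq 0$, $i\geq 1$ and $k\geq 3$, \begin{align*} \bar a_{2^ki-2^{k-1}-2}(8n+5)&\equiv 0 \pmod{2^{k+1}},\\ \bar a_{2^ki-2^{k-1}-2}(8n+7)&\equiv 0 \pmod{2^{k+2}}. \end{align*}
   Context: For an integer $k\geq 1$ let $f_k:=\prod_{n\geq 1}(1-q^{kn})$. For an integer $c\geq1$, the generalized overcubic partition function $\bar a_c(n)$ is defined by the generating function $\sum_{n\geq 0}\bar a_c(n)q^n=\dfrac{f_4^{c-1}}{f_1^2f_2^{2c-3}}$. *)

(* Defs.v *)
(* Formal power series in q are handled through truncations:
   the coefficient of q^n of a product of the series below only depends on
   their truncations modulo q^(n+1), which are polynomials over int. *)
From mathcomp Require Import all_boot all_order all_algebra.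
Set Implicit Arguments. Unset Strict Implicit. Unset Printing Implicit Defensive.
Import Order.TTheory GRing.Theory Num.Theory.
Local Open Scope ring_scope.

(* f_k = prod_{m>=1} (1 - q^(k m)), truncated: the factors with m > N
   are congruent to 1 modulo q^(N+1) (for k >= 1). *)
Definition f_trunc (k N : nat) : {poly int} :=
  \prod_(1 <= m < N.+1) (1 - 'X^(k * m)).

(* 1/(1 - q^j) = sum_{t>=0} q^(j t), truncated modulo q^(N+1) (j >= 1). *)
Definition geom_trunc (j N : nat) : {poly int} :=
  \sum_(t < (N %/ j).+1) 'X^(j * t).

Definition finv_trunc (k N : nat) : {poly int} :=
  \prod_(1 <= m < N.+1) geom_trunc (k * m) N.

(* f_2^(-(2c-3)) : for c = 1 the exponent 2c-3 = -1, i.e. a factor f_2. *)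
Definition f2_negpow_trunc (c N : nat) : {poly int} :=
  if (3 <= 2 * c)%N then finv_trunc 2 N ^+ (2 * c - 3)
  else f_trunc 2 N ^+ (3 - 2 * c).

(* Generalized overcubic partition function:
   sum_n abar c n q^n = f_4^(c-1) / (f_1^2 f_2^(2c-3)), for c >= 1. *)
Definition abar (c n : nat) : int :=
  (f_trunc 4 n ^+ (c - 1) * finv_trunc 1 n ^+ 2 * f2_negpow_trunc c n)`_n.

(* Main.v *)
Require Import Defs.
From mathcomp Require Import all_boot all_order all_algebra.
From mathcomp Require Import ring zify.
Set Implicit Arguments. Unset Strict Implicit. Unset Printing Implicit Defensive.
Import Order.TTheory GRing.Theory Num.Theory.
Local Open Scope ring_scope.

(* With phi(q) = sum_n q^(n^2) over all integers n, Gauss' product for phi(-q)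
   and phi(q) phi(-q) = phi(-q^2)^2 turn the generating function into
   phi(q) phi(-q^2) / phi(-q^2)^(c+2).  Here c + 2 = 2^(k-1) M, so writing
   phi(-q^2) = 1 + 2 s and phi(q) = 1 + 2 t the denominator is
   1 + 2^k B with B = M (s + s^2) + 2 V a series in q^2.  Modulo 2^(2k) the
   coefficients are therefore those of (1 + 2 t)(1 + 2 s)(1 - 2^k B).  In odd
   degrees only 2 t (1 + 2 s) and 2^(k+1) t (1 + 2 s) B contribute; the former
   is supported on x^2 + 2 y^2, which is never 5 or 7 modulo 8, and the
   latter is, modulo 2^(k+2), supported on x^2 + 2 y^2 and x^2 + 4 y^2, which
   are never 7 modulo 8. *)

(** * Gauss' product for phi(-q) and its consequences, at a nilpotent [x] *)

Section ThetaProduct.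
Variable R : comNzRingType.
Implicit Types x : R.

(* The truncation of [phi(-q)] at [q = x]. *)
Definition theta x N : R := 1 + 2 * \sum_(1 <= n < N.+1) (-1) ^+ n * x ^+ (n ^ 2).

Section Shanks.
Variables (x : R) (v : nat -> R).
Hypothesis vP : forall i, (0 < i)%N -> v i * (1 + x ^+ i) = 1.

Let r i := (1 - x ^+ i) * v i.
Let P s n := \prod_(s.+1 <= i < n.+1) r i.

Let PS s n : (s <= n)%N -> P s n.+1 = P s n * r n.+1.
Proof. by move=> le_sn; rewrite /P big_nat_recr. Qed.

Let Pr s n : (s < n)%N -> P s n = r s.+1 * P s.+1 n.
Proof. by move=> lt_sn; rewrite /P big_ltn. Qed.

Let Pnn n : P n n = 1.
Proof. by rewrite /P big_geq. Qed.

(** The left side collects the changes, as [n] becomes [n.+1], of the terms of index at most [m] in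
    the finite form of [theta_shanks]; they telescope in [m]. *)
Lemma shanks_step n m : (m <= n)%N ->
  P 0 n * (r n.+1 - 1) + 2 * \sum_(1 <= s < m.+1)
     (-1) ^+ s * P s n * v s * x ^+ (s * n.+1) * (x ^+ s * r n.+1 - 1)
  = 2 * (-1) ^+ m.+1 * P m n * v n.+1 * x ^+ (m.+1 * n.+1).
Proof.
have vn := @vP n.+1 isT.
elim: m => [|m IHm] lt_mn.
  rewrite big_geq // mulr0 addr0 mul1n expr1 /r.
  set y := x ^+ n.+1 in vn *; set w := v n.+1 in vn *.
  rewrite -[X in _ - X]vn; ring.
rewrite big_nat_recr //= [2 * (_ + _)]mulrDr addrA IHm ?(ltnW lt_mn) //.
have vm := @vP m.+1 isT.
rewrite (Pr lt_mn) [(m.+2 * _)%N]mulSn exprD [(-1) ^+ m.+2]exprS /r.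
set z := x ^+ (m.+1 * n.+1); set e := (-1) ^+ m.+1.
set y := x ^+ n.+1 in vn *; set w := v n.+1 in vn *.
set y' := x ^+ m.+1 in vm *; set w' := v m.+1 in vm *.
set p := P _ _.
(* A lone 1 is written as [w * (1 + y)]; the bracket then collapses to [- w * y * w' * (1 + y')],
   and [vm] removes the last two factors. *)
transitivity (2 * e * p * z * ((1 - y') * w' * w + w' * (y' * (1 - y) * w - w * (1 + y))));
  first by rewrite vn; ring.
transitivity (2 * e * p * z * (- (w * y * (w' * (1 + y'))))); first by ring.
by rewrite vm; ring.
Qed.

(* Shanks' finite form of Gauss' identity; the error terms vanish once
   [x ^+ n.+1 = 0]. *)
Lemma theta_shanks n :
  theta x n = P 0 n
    + 2 * \sum_(1 <= s < n.+1) (-1) ^+ s * P s n * v s * x ^+ (s * n.+1).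
Proof.
elim: n => [|n IHn]; first by rewrite /theta !big_geq // Pnn.
have vn := @vP n.+1 isT.
have step := shanks_step (leqnn n).
have -> : theta x n.+1 = theta x n + 2 * ((-1) ^+ n.+1 * x ^+ (n.+1 ^ 2)).
  by rewrite /theta big_nat_recr //=; ring.
rewrite [in RHS]big_nat_recr //= !Pnn IHn PS //.
have -> : \sum_(1 <= s < n.+1) (-1) ^+ s * P s n.+1 * v s * x ^+ (s * n.+2)
  = \sum_(1 <= s < n.+1) (-1) ^+ s * P s n * v s * x ^+ (s * n.+1)
  + \sum_(1 <= s < n.+1) (-1) ^+ s * P s n * v s * x ^+ (s * n.+1)
       * (x ^+ s * r n.+1 - 1).
  rewrite -big_split; apply: eq_big_nat => s /andP[_ lt_sn] /=.
  by rewrite PS // [(s * n.+2)%N]mulnS exprD; ring.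
move: step; rewrite Pnn -mulnn [(n.+1 * n.+2)%N]mulnS exprD.
set T := \sum_(_ <= _ < _) _; set S := \sum_(_ <= _ < _) _.
set z := x ^+ (n.+1 * n.+1); set e := (-1) ^+ n.+1.
set y := x ^+ n.+1 in vn *; set w := v n.+1 in vn * => step.
(* The new square term [2 * e * z] splits as [2 * e * z * w], which is the closed form in [step],
   plus [2 * e * z * w * y], which is the new summand [s = n.+1]. *)
transitivity (P 0 n + 2 * S + 2 * (e * z) * (w * (1 + y))); first by rewrite vn; ring.
transitivity (P 0 n + 2 * S + (2 * e * 1 * w * z) + 2 * e * z * w * y);
  first by ring.
by rewrite -step; ring.
Qed.

End Shanks.

Lemma theta_prod x N : x ^+ N.+1 = 0 ->
  theta x N * \prod_(1 <= i < N.+1) (1 + x ^+ i)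
  = \prod_(1 <= i < N.+1) (1 - x ^+ i).
Proof.
move=> x0.
pose v i := \sum_(j < N.+1) (- x ^+ i) ^+ j.
have vP i : (0 < i)%N -> v i * (1 + x ^+ i) = 1.
  move=> i_gt0; have := subrX1 (- x ^+ i) N.+1.
  rewrite exprNn -exprM mulnC exprM x0 expr0n gtn_eqF // mulr0 sub0r => h.
  by rewrite -[RHS]opprK h /v; ring.
rewrite (theta_shanks vP) [X in _ + 2 * X]big_nat [X in _ + 2 * X]big1; last first.
  by move=> s /andP[s_gt0 _]; rewrite mulnC exprM x0 expr0n gtn_eqF // mulr0.
rewrite mulr0 addr0 -big_split; apply: eq_big_nat => i /andP[i_gt0 _] /=.
by rewrite -mulrA vP ?mulr1.
Qed.

(** For [n > N] the exponent [n ^ 2] also exceeds [N], so the extra terms vanish. *)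
Lemma theta_nilp_ext x N M : x ^+ N.+1 = 0 -> (N <= M)%N -> theta x M = theta x N.
Proof.
move=> x0 le_NM; congr (1 + 2 * _).
rewrite (big_cat_nat _ (n := N.+1)) //= [X in _ + X]big_nat [X in _ + X]big1 ?addr0 //.
move=> n /andP[lt_Nn _].
have le_n2 : (N.+1 <= n ^ 2)%N by rewrite (leq_trans lt_Nn) // -mulnn leq_pmulr; lia.
by rewrite -(subnK le_n2) exprD x0 !mulr0.
Qed.

Lemma big_nat_odd_even (F : nat -> R) n :
  \prod_(1 <= i < (2 * n).+1) F i
  = \prod_(0 <= j < n) F (2 * j).+1 * \prod_(1 <= j < n.+1) F (2 * j)%N.
Proof.
elim: n => [|n IHn]; first by rewrite !big_geq // mulr1.
rewrite mulnS addSn addSn add0n 2?big_nat_recr //= IHn.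
rewrite [in RHS]big_nat_recr // [X in _ = _ * X]big_nat_recr //=.
by rewrite mulnS addSn addSn add0n; ring.
Qed.

Lemma exprN_odd_even x j :
  (- x) ^+ (2 * j) = x ^+ (2 * j) /\ (- x) ^+ (2 * j).+1 = - x ^+ (2 * j).+1.
Proof. by rewrite !exprS !exprM sqrrN mulNr. Qed.

Lemma inv_1Dnilp (y : R) n : y ^+ n = 0 -> exists z, (1 + y) * z = 1.
Proof.
move=> y0; exists (\sum_(j < n) (- y) ^+ j).
have := subrX1 (- y) n; rewrite exprNn y0 mulr0 sub0r => h.
by rewrite -[RHS]opprK h; ring.
Qed.

Lemma inv_prod_1Dnilp (I : Type) (r : seq I) (P : pred I) (y : I -> R) n :
    (forall i, P i -> y i ^+ n = 0) ->
  exists z, \prod_(i <- r | P i) (1 + y i) * z = 1.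
Proof.
move=> y0; elim/big_rec: _ => [|i a Pi [z za]]; first by exists 1; rewrite mulr1.
have [w wi] := inv_1Dnilp (y0 i Pi).
by exists (w * z); rewrite mulrACA wi za mulr1.
Qed.

(** Replacing [x] by [- x] swaps the odd-index factors of the numerator and the denominator in
    Gauss' product and fixes the even ones. In the product of the two formulas the odd parts cancel,
    and the even parts form the square of the formula for [x ^+ 2]. *)
Lemma theta_mulN x N : x ^+ N.+1 = 0 ->
  theta x N * theta (- x) N = theta (x ^+ 2) N ^+ 2.
Proof.
move=> x0; have N0 : (- x) ^+ N.+1 = 0 by rewrite exprNn x0 mulr0.
have x20 : (x ^+ 2) ^+ N.+1 = 0 by rewrite -exprM mulnC exprM x0 expr0n.
have le_N2N : (N <= 2 * N)%N by rewrite leq_pmull.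
have ext0 (y : R) : y ^+ N.+1 = 0 -> y ^+ (2 * N).+1 = 0.
  by move=> y0; rewrite -(subnK (_ : N.+1 <= (2 * N).+1)%N) // exprD y0 mulr0.
(* Truncating at [2 * N] gives [N] odd and [N] even indices, the even ones matching the product for
   [x ^+ 2] truncated at [N]. *)
rewrite -(theta_nilp_ext x0 le_N2N) -(theta_nilp_ext N0 le_N2N).
have e1 := theta_prod (ext0 _ x0); have e2 := theta_prod (ext0 _ N0).
have e3 := theta_prod x20.
rewrite !big_nat_odd_even in e1 e2.
set O1 := \prod_(0 <= j < N) (1 + _) in e1.
set O2 := \prod_(0 <= j < N) (1 - _) in e1.
have eO1 : \prod_(0 <= j < N) (1 + (- x) ^+ (2 * j).+1) = O2.
  by apply: eq_bigr => j _; rewrite (exprN_odd_even _ _).2.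
have eO2 : \prod_(0 <= j < N) (1 - (- x) ^+ (2 * j).+1) = O1.
  by apply: eq_bigr => j _; rewrite (exprN_odd_even _ _).2 opprK.
have eE1 : \prod_(1 <= j < N.+1) (1 + (- x) ^+ (2 * j))
    = \prod_(1 <= j < N.+1) (1 + (x ^+ 2) ^+ j).
  by apply: eq_bigr => j _; rewrite (exprN_odd_even _ _).1 exprM.
have eE2 : \prod_(1 <= j < N.+1) (1 - (- x) ^+ (2 * j))
    = \prod_(1 <= j < N.+1) (1 - (x ^+ 2) ^+ j).
  by apply: eq_bigr => j _; rewrite (exprN_odd_even _ _).1 exprM.
have eE3 : \prod_(1 <= j < N.+1) (1 + x ^+ (2 * j))
    = \prod_(1 <= j < N.+1) (1 + (x ^+ 2) ^+ j).
  by apply: eq_bigr => j _; rewrite exprM.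
have eE4 : \prod_(1 <= j < N.+1) (1 - x ^+ (2 * j))
    = \prod_(1 <= j < N.+1) (1 - (x ^+ 2) ^+ j).
  by apply: eq_bigr => j _; rewrite exprM.
rewrite eO1 eO2 eE1 eE2 in e2; rewrite eE3 eE4 in e1.
have [u1 O1u] : exists u, O1 * u = 1.
  apply: (inv_prod_1Dnilp _ (n := N.+1)) => j _.
  by rewrite -exprM mulnC exprM x0 expr0n.
have [u2 O2u] : exists u, O2 * u = 1.
  apply: (inv_prod_1Dnilp _ (n := N.+1)) => j _.
  by rewrite exprNn -exprM mulnC exprM x0 expr0n mulr0.
move: e1 e2 e3; set E := \prod_(1 <= j < N.+1) (1 + _).
have [u Eu] : exists u, E * u = 1.
  rewrite /E big_nat; apply: (inv_prod_1Dnilp _ (n := N.+1)) => j /andP[j_gt0 _].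
  by rewrite -exprM mulnC exprM x20 expr0n gtn_eqF.
set E' := \prod_(1 <= j < N.+1) (1 - _) => e1 e2 e3.
set a := theta x _ in e1 *; set b := theta (- x) _ in e2 *.
set c := theta _ N in e3 *.
transitivity (a * (O1 * u1) * (E * u) * (b * (O2 * u2) * (E * u))).
  by rewrite O1u O2u Eu !mulr1.
transitivity ((a * (O1 * E)) * (b * (O2 * E)) * (u1 * u2 * u ^+ 2)); first by ring.
rewrite e1 e2 -e3.
transitivity (c ^+ 2 * (O1 * u1) * (O2 * u2) * (E * u) ^+ 2); first by ring.
by rewrite O1u O2u Eu expr1n !mulr1.
Qed.

(* [phi(-q) f_2 = f_1 ^ 2]. *)
Lemma theta_euler x N : x ^+ N.+1 = 0 ->
  theta x N * \prod_(1 <= m < N.+1) (1 - x ^+ (2 * m))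
  = (\prod_(1 <= m < N.+1) (1 - x ^+ m)) ^+ 2.
Proof.
move=> x0; rewrite expr2 -[X in _ = X * _](theta_prod x0) -mulrA -big_split.
congr (_ * _); apply: eq_bigr => m _ /=.
by rewrite mulnC exprM; ring.
Qed.

(** Of the [c + 2] factors phi(-q^2), [c - 1] turn f_4^(c-1) into f_2^(2c-2), which leaves one f_2
    after division by f_2^(2c-3). Two more become phi(q) phi(-q); then phi(-q) f_2 = f_1^2 cancels
    [g1 ^+ 2], and the last factor remains. *)
Lemma overcubic_theta x N c g1 g2 : (2 <= c)%N -> x ^+ N.+1 = 0 ->
    (\prod_(1 <= m < N.+1) (1 - x ^+ m)) * g1 = 1 ->
    (\prod_(1 <= m < N.+1) (1 - x ^+ (2 * m))) * g2 = 1 ->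
  (\prod_(1 <= m < N.+1) (1 - x ^+ (4 * m))) ^+ (c - 1) * g1 ^+ 2
     * g2 ^+ (2 * c - 3) * theta (x ^+ 2) N ^+ (c + 2)
  = theta (- x) N * theta (x ^+ 2) N.
Proof.
move=> c_ge2 x0.
have x20 : (x ^+ 2) ^+ N.+1 = 0 by rewrite -exprM mulnC exprM x0 expr0n.
have e1 := theta_euler x0; have e2 := theta_euler x20; have e3 := theta_mulN x0.
have eF2 : \prod_(1 <= m < N.+1) (1 - (x ^+ 2) ^+ m)
    = \prod_(1 <= m < N.+1) (1 - x ^+ (2 * m)).
  by apply: eq_bigr => m _; rewrite exprM.
have eF4 : \prod_(1 <= m < N.+1) (1 - (x ^+ 2) ^+ (2 * m))
    = \prod_(1 <= m < N.+1) (1 - x ^+ (4 * m)).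
  by apply: eq_bigr => m _; rewrite -exprM mulnA.
rewrite eF2 eF4 in e2.
move: e1 e2 e3; set F1 := \prod_(_ <= m < _) (1 - x ^+ m).
set F2 := \prod_(_ <= m < _) (1 - x ^+ (2 * m)).
set F4 := \prod_(_ <= m < _) (1 - x ^+ (4 * m)).
set a := theta x N; set b := theta (- x) N; set p := theta _ N.
move=> e1 e2 e3 F1g F2g.
have [d ->] : exists d, c = d.+2 by exists (c - 2)%N; lia.
have -> : (d.+2 - 1 = d.+1)%N by lia.
have -> : (2 * d.+2 - 3 = 2 * d + 1)%N by lia.
have -> : (d.+2 + 2 = d.+1 + 3)%N by lia.
transitivity ((p * F4) ^+ d.+1 * g2 ^+ (2 * d + 1) * p ^+ 2 * g1 ^+ 2 * p).
  by rewrite exprMn [p ^+ (_ + 3)]exprD; ring.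
rewrite e2 -e3.
transitivity (F2 * (F2 * g2) ^+ (2 * d + 1) * (a * b) * g1 ^+ 2 * p).
  by rewrite [(F2 * g2) ^+ _]exprMn -exprM (_ : 2 * d.+1 = (2 * d + 1).+1)%N ?exprS; [ring | lia].
rewrite F2g expr1n mulr1.
transitivity ((a * F2) * b * g1 ^+ 2 * p); first by ring.
rewrite e1; transitivity ((F1 * g1) ^+ 2 * b * p); first by ring.
by rewrite F1g expr1n mul1r.
Qed.

End ThetaProduct.

Lemma theta_rmorph (R S : comNzRingType) (f : {rmorphism R -> S}) x N :
  f (theta x N) = theta (f x) N.
Proof.
rewrite /theta rmorphD rmorph1 rmorphM rmorph_nat rmorph_sum.
congr (1 + _ * _); apply: eq_bigr => n _.
by rewrite rmorphM !rmorphXn rmorphN rmorph1.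
Qed.

(** * Transfer to polynomials modulo ['X^(N.+1)] *)

Section Truncation.
Variable N : nat.
Local Notation tr := (in_qpoly ('X^(N.+1) : {poly int})).

Lemma in_qpoly_X0 : tr 'X ^+ N.+1 = 0.
Proof.
rewrite -rmorphXn; apply: val_inj => /=.
rewrite mk_monic_Xn.
exact: Pdiv.RingMonic.rmodpp (monicXn _ _).
Qed.

Lemma in_qpoly_coef (p q : {poly int}) : tr p = tr q -> p`_N = q`_N.
Proof.
move=> /(congr1 val) /=; rewrite mk_monic_Xn.
move=> e; apply/eqP; rewrite -subr_eq0 -coefB; apply/eqP.
have mX := monicXn int N.+1.
rewrite (Pdiv.RingMonic.rdivp_eq mX (p - q)) Pdiv.RingMonic.rmodpB // e subrr.
by rewrite addr0 coefMXn ltnSn.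
Qed.

(** The product telescopes to 1 minus a power of ['X] whose exponent exceeds [N]. *)
Lemma in_qpoly_geom j : (0 < j)%N -> tr ((1 - 'X^j) * geom_trunc j N) = 1.
Proof.
move=> j_gt0; have := subrX1 ('X^j : {poly int}) (N %/ j).+1.
rewrite -exprM => e.
have -> : (1 - 'X^j) * geom_trunc j N = 1 - 'X^(j * (N %/ j).+1).
  rewrite -[RHS]opprB e -mulNr opprB; congr (_ * _).
  by apply: eq_bigr => i _; rewrite exprM.
have le_N : (N.+1 <= j * (N %/ j).+1)%N by rewrite mulnC ltn_ceil.
by rewrite rmorphB rmorph1 rmorphXn -(subnK le_N) exprD in_qpoly_X0 mulr0 subr0.
Qed.

Lemma in_qpoly_f_trunc k :
  tr (f_trunc k N) = \prod_(1 <= m < N.+1) (1 - tr 'X ^+ (k * m)).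
Proof.
by rewrite rmorph_prod; apply: eq_bigr => m _; rewrite rmorphB rmorph1 rmorphXn.
Qed.

Lemma in_qpoly_finv_trunc k : (0 < k)%N ->
  tr (f_trunc k N) * tr (finv_trunc k N) = 1.
Proof.
move=> k_gt0; rewrite -rmorphM -big_split rmorph_prod big_nat big1 // => m.
by case/andP=> m_gt0 _; rewrite /= in_qpoly_geom ?muln_gt0 ?k_gt0.
Qed.

(** The polynomial whose coefficient of degree [N] is [abar c N]. *)
Definition overcubic_trunc c : {poly int} :=
  f_trunc 4 N ^+ (c - 1) * finv_trunc 1 N ^+ 2 * f2_negpow_trunc c N.

Lemma in_qpoly_overcubic c : (2 <= c)%N ->
  tr (overcubic_trunc c * theta ('X ^+ 2) N ^+ (c + 2))
  = tr (theta (- 'X) N * theta ('X ^+ 2) N).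
Proof.
move=> c_ge2; have X0 := in_qpoly_X0.
have F1 := @in_qpoly_finv_trunc 1 isT; have F2 := @in_qpoly_finv_trunc 2 isT.
rewrite in_qpoly_f_trunc in F1; rewrite in_qpoly_f_trunc in F2.
have F1' : \prod_(1 <= m < N.+1) (1 - tr 'X ^+ m) * tr (finv_trunc 1 N) = 1.
  by move: F1; under eq_bigr do rewrite mul1n.
have := overcubic_theta c_ge2 X0 F1' F2.
rewrite -in_qpoly_f_trunc /overcubic_trunc /f2_negpow_trunc ifT; last by lia.
have -> : tr 'X ^+ 2 = tr ('X ^+ 2) by rewrite rmorphXn.
have -> : - tr 'X = tr (- 'X) by rewrite rmorphN.
rewrite -!theta_rmorph.
move: (f_trunc 4 N) (finv_trunc 1 N) (finv_trunc 2 N) (theta _ N) (theta _ N).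
move=> f4 g1 g2 p2 p1.
by rewrite !rmorphM [in X in X = _ -> _]/= !rmorphXn.
Qed.

End Truncation.

(** * Exponents modulo 8 *)

Section Support.
Implicit Types (A B C : seq nat) (p q : {poly int}).

Definition supp8 A p := forall j, p`_j != 0 -> (j %% 8)%N \in A.

Lemma supp8_coef0 A p j : supp8 A p -> (j %% 8)%N \notin A -> p`_j = 0.
Proof. by move=> Ap; apply: contraNeq => /Ap. Qed.

Lemma supp8_sub A B p : {subset A <= B} -> supp8 A p -> supp8 B p.
Proof. by move=> AB Ap j /Ap /AB. Qed.

Lemma supp8D A p q : supp8 A p -> supp8 A q -> supp8 A (p + q).
Proof.
move=> Ap Aq j; apply: contraNT => Aj.
by rewrite coefD (supp8_coef0 Ap Aj) (supp8_coef0 Aq Aj).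
Qed.

Lemma supp8_sum A (I : Type) (r : seq I) (P : pred I) (F : I -> {poly int}) :
  (forall i, P i -> supp8 A (F i)) -> supp8 A (\sum_(i <- r | P i) F i).
Proof.
move=> AF; apply: big_ind => //; first by move=> j; rewrite coef0 eqxx.
exact: supp8D.
Qed.

(** The condition on sums of residues is boolean, so for explicit lists it is settled by
    computation. *)
Lemma supp8M A B C p q :
    all (fun a => all (fun b => (a + b) %% 8 \in C)%N B) A ->
  supp8 A p -> supp8 B q -> supp8 C (p * q).
Proof.
move=> ABC Ap Bq j; apply: contraNT => Cj; rewrite coefM big1 // => i _.
have [/eqP->|/Ap Ai] := boolP (p`_i == 0); first by rewrite mul0r.
have [/eqP->|/Bq Bi] := boolP (q`_(j - i) == 0); first by rewrite mulr0.
have := allP (allP ABC _ Ai) _ Bi.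
by rewrite /= modnDm subnKC ?leq_ord // (negPf Cj).
Qed.

Lemma supp8C A c : 0%N \in A -> supp8 A c%:P.
Proof. by move=> A0 j; rewrite coefC; case: j => //= j; rewrite eqxx. Qed.

Lemma supp8_Xn A m : (m %% 8)%N \in A -> supp8 A 'X^m.
Proof. by move=> Am j; rewrite coefXn; case: (j =P m) => [->|_]; rewrite ?eqxx. Qed.

Lemma supp8_signM A n p : supp8 A p -> supp8 A ((-1) ^+ n * p).
Proof.
move=> Ap j; rewrite -signr_odd mulr_sign; case: odd; last exact: Ap.
by rewrite coefN oppr_eq0; apply: Ap.
Qed.

Lemma supp8_natM A m p : supp8 A p -> supp8 A (m%:R * p).
Proof.
by move=> Ap j; rewrite mulr_natl coefMn mulrn_eq0 negb_or => /andP[_ /Ap].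
Qed.

Lemma supp8_comp v p : supp8 [:: 0; 2; 4; 6]%N p ->
  supp8 [:: 0; 2; 4; 6]%N (v \Po p).
Proof.
move=> Ep; elim/poly_ind: v => [|v c IHv].
  by rewrite comp_poly0; apply: (@supp8C _ 0).
rewrite comp_polyD comp_polyM comp_polyX comp_polyC.
by apply: supp8D; [apply: supp8M IHv Ep | apply: supp8C].
Qed.

End Support.

Lemma sqr_mod8 n : (n ^ 2 %% 8)%N \in [:: 0; 1; 4]%N.
Proof.
rewrite -mulnn -modnMm.
have : (n %% 8 < 8)%N by rewrite ltn_pmod.
by move: (n %% 8)%N; do 8!case=> //.
Qed.

(** Cross terms come in pairs. Modulo 2 this leaves only exponents 4 n^2 in the square of the series
    [s]. *)
Lemma sqr_sum_mod2 (R : comNzRingType) (I : Type) (r : seq I) (F : I -> R) :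
  exists z, (\sum_(i <- r) F i) ^+ 2 = \sum_(i <- r) F i ^+ 2 + 2 * z.
Proof.
elim: r => [|i r [z e]]; first by exists 0; rewrite !big_nil; ring.
exists (F i * \sum_(j <- r) F j + z).
rewrite !big_cons sqrrD e -mulr_natl; ring.
Qed.

(** * Expansion of powers of [1 + 2 * u] with highly even exponent *)

Section BinaryPower.
Variable R : comNzRingType.
Implicit Types u w : R.

(** Each squaring doubles the deviation from 1, up to a square that is absorbed into [v]. *)
Lemma pow2_1D4 u e : exists v, (1 + 4 * u) ^+ (2 ^ e) = 1 + 2 ^+ e.+2 * (u + 2 * v).
Proof.
elim: e => [|e [v ev]]; first by exists 0; rewrite !exprS; ring.
exists (v + 2 ^+ e * (u + 2 * v) ^+ 2).
by rewrite expnSr exprM ev !exprS expr0; ring.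
Qed.

Lemma exp_1D2X w e M :
  exists v, (1 + 2 ^+ e.+1 * w) ^+ M = 1 + 2 ^+ e.+1 * (M%:R * w + 2 * v).
Proof.
elim: M => [|M [v ev]]; first by exists 0; rewrite expr0; ring.
exists (v + 2 ^+ e * (M%:R * w + 2 * v) * w).
by rewrite exprSr ev -natr1 !exprS; ring.
Qed.

Lemma exp_1D2_pow2 u e M : exists v, (1 + 2 * u) ^+ (2 ^ e.+1 * M)
  = 1 + 2 ^+ e.+2 * (M%:R * (u + u ^+ 2) + 2 * v).
Proof.
have [v0 e0] := pow2_1D4 (u + u ^+ 2) e.
have [v1 e1] := exp_1D2X (u + u ^+ 2 + 2 * v0) e.+1 M.
exists (M%:R * v0 + v1); rewrite expnS -mulnA exprM.
have -> : (1 + 2 * u) ^+ 2 = 1 + 4 * (u + u ^+ 2) by ring.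
by rewrite exprM e0 e1; ring.
Qed.

End BinaryPower.

(** The correction term of [exp_1D2_pow2] is merely some ring element. Expanding at ['X] and then
    substituting [s] makes it a polynomial in [s], so that [supp8_comp] shows its exponents to be
    even. *)
Lemma comp_1D2X (s v : {poly int}) n a m :
    (1 + 2 * 'X) ^+ n = 1 + a%:R * (m%:R * ('X + 'X ^+ 2) + 2 * v) ->
  (1 + 2 * s) ^+ n = 1 + a%:R * (m%:R * (s + s ^+ 2) + 2 * (v \Po s)).
Proof.
move=> /(congr1 (comp_poly s)).
by rewrite rmorphXn !(rmorphD, rmorph1, rmorphM) !rmorph_nat /= comp_polyX.
Qed.

(** * Coefficients in degrees 5 and 7 modulo 8 *)

Section Coefficients.
Variables (N e M : nat).

Let t : {poly int} := \sum_(1 <= n < N.+1) (-1) ^+ n * (- 'X) ^+ (n ^ 2).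
Let s : {poly int} := \sum_(1 <= n < N.+1) (-1) ^+ n * ('X ^+ 2) ^+ (n ^ 2).

Let supp_t : supp8 [:: 0; 1; 4]%N t.
Proof.
apply: supp8_sum => n _; apply: supp8_signM; rewrite exprNn.
exact/supp8_signM/supp8_Xn/sqr_mod8.
Qed.

Let supp_s : supp8 [:: 0; 2]%N s.
Proof.
apply: supp8_sum => n _; apply: supp8_signM; rewrite -exprM; apply: supp8_Xn.
rewrite -modnMmr; move: (sqr_mod8 n).
by rewrite !inE => /or3P[] /eqP->.
Qed.

Let s_sqr : exists q z, supp8 [:: 0; 4]%N q /\ s ^+ 2 = q + 2 * z.
Proof.
have [z ->] := sqr_sum_mod2 (index_iota 1 N.+1)
  (fun n => (-1) ^+ n * ('X ^+ 2) ^+ (n ^ 2) : {poly int}).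
eexists; exists z; split; last reflexivity.
apply: supp8_sum => n _; rewrite exprMn sqrr_sign mul1r -!exprM.
apply: supp8_Xn; rewrite mulnAC -modnMmr; move: (sqr_mod8 n).
by rewrite !inE => /or3P[] /eqP->.
Qed.

Let evens := [:: 0; 2; 4; 6]%N.

(** Here k = [e.+3], so the powers of 2 are 2^(2k) and 2^(k+1), and an even [b] gains the further
    factor needed in degrees 7 modulo 8. *)
Lemma overcubic_coef c : c = (2 ^ e.+2 * M - 2)%N -> (2 <= c)%N ->
  (N %% 8 \in [:: 5; 7])%N ->
  exists a b : int, (overcubic_trunc N c)`_N
    = 2 ^+ (2 * e.+3) * a + 2 ^+ e.+4 * b /\ ((N %% 8 = 7)%N -> (2 %| b)%Z).
Proof.
move=> def_c c_ge2 N57.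
have Es : supp8 evens s by apply: supp8_sub supp_s => a; rewrite !inE; lia.
have [v0 ev0] := exp_1D2_pow2 ('X : {poly int}) e.+1 M.
have {v0 ev0} [V EV es] : exists2 V, supp8 evens V &
    (1 + 2 * s) ^+ (2 ^ e.+2 * M) = 1 + 2 ^+ e.+3 * (M%:R * (s + s ^+ 2) + 2 * V).
  exists (v0 \Po s); first exact: supp8_comp.
  by rewrite -natrX; apply: comp_1D2X; rewrite natrX.
set B := _ + 2 * V in es.
have EB : supp8 evens B.
  apply: supp8D; last exact: supp8_natM.
  by apply/supp8_natM/supp8D => //; rewrite expr2; apply: (supp8M _ Es Es).
have := @in_qpoly_overcubic N c c_ge2.
have -> : (c + 2 = 2 ^ e.+2 * M)%N by lia.
rewrite (_ : theta ('X ^+ 2) N = 1 + 2 * s) // (_ : theta (- 'X) N = 1 + 2 * t) //.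
rewrite es => eY.
set Y := overcubic_trunc N c in eY *.
have {}eY : Y`_N = (2 ^+ (2 * e.+3) * (Y * B ^+ 2)
    + ((1 + 2 * s) * (1 - 2 ^+ e.+3 * B) + 2 * (t * (1 + 2 * s)))
    - 2 ^+ e.+4 * (t * (1 + 2 * s) * B))`_N.
  apply: in_qpoly_coef; rewrite [2 ^+ e.+4]exprS [(2 * _)%N]mulnC exprM.
  move: (2 ^+ e.+3) eY => w eY.
  (* An exact form of 1/(1 + w B) = 1 - w B modulo w^2; [eY] then replaces [Y * (1 + w * B)] by the
     product of the two theta series. *)
  have eYw : Y = w ^+ 2 * (Y * B ^+ 2) + Y * (1 + w * B) * (1 - w * B) by ring.
  rewrite {1}eYw; move: (w ^+ 2 * _) eY => L eY.
  rewrite rmorphD [X in _ + X]rmorphM [_ (Y * _)]eY -[X in _ + X]rmorphM -rmorphD.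
  by congr in_qpoly; ring.
have coef2X m (p : {poly int}) : (2 ^+ m * p)`_N = 2 ^+ m * p`_N.
  by rewrite -!natrX !mulr_natl coefMn.
have s1 (A : seq nat) : 0%N \in A -> supp8 A 1 by apply: supp8C.
have E1 : supp8 [:: 0; 2]%N (1 + 2 * s).
  by apply: supp8D; [exact: s1 | exact: supp8_natM].
have Et : supp8 [:: 0; 1; 2; 3; 4; 6]%N (t * (1 + 2 * s)).
  by apply: (supp8M _ supp_t E1).
have E2 : supp8 evens ((1 + 2 * s) * (1 - 2 ^+ e.+3 * B)).
  apply: (supp8M (B := evens) _ E1) => //; apply: supp8D; first exact: s1.
  rewrite -mulrN1 mulrC -[-1]expr1; apply: supp8_signM.
  by rewrite -natrX; apply: supp8_natM.
exists (Y * B ^+ 2)`_N, (- (t * (1 + 2 * s) * B)`_N); split.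
  rewrite eY coefB !coefD !coef2X (supp8_coef0 E2) ?add0r; last first.
    by move: N57; rewrite !inE => /orP[] /eqP->.
  rewrite mulr_natl coefMn (supp8_coef0 Et) ?mul0rn ?addr0 ?mulrN //.
  by move: N57; rewrite !inE => /orP[] /eqP->.
move=> N7; have [q [z [q4 eq4]]] := s_sqr.
(* Modulo 2 only [t * s] and [t * q] survive, with exponents x^2 + 2 y^2 and x^2 + 4 y^2; neither
   reaches 7 modulo 8. *)
have -> : t * (1 + 2 * s) * B = M%:R * (t * s + t * q)
    + 2 * (M%:R * (t * z) + t * V + t * s * B).
  by rewrite /B eq4; ring.
have E7 : supp8 [:: 0; 1; 2; 3; 4; 5; 6]%N (t * s + t * q).
  by apply: supp8D; [apply: (supp8M _ supp_t supp_s) | apply: (supp8M _ supp_t q4)].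
rewrite coefD (supp8_coef0 (supp8_natM (m := M) E7)) ?N7 // add0r.
rewrite mulr_natl coefMn rpredN; apply/dvdzP.
by eexists; rewrite -[LHS]mulr_natr.
Qed.

End Coefficients.

Theorem theorem1p7 (n i k : nat) (hi : (1 <= i)%N) (hk : (3 <= k)%N) :
  let c := (2 ^ k * i - 2 ^ (k - 1) - 2)%N in
  ((2 ^ (k + 1))%:Z %| abar c (8 * n + 5))%Z /\
  ((2 ^ (k + 2))%:Z %| abar c (8 * n + 7))%Z.
Proof.
move=> c.
have [e def_k] : exists e, k = e.+3 by exists (k - 3)%N; lia.
(* Thus c + 2 = 2^(k-1) M with M = 2 i - 1. *)
have def_c : c = (2 ^ e.+2 * (2 * i - 1) - 2)%N.
  by rewrite /c def_k subn1 /= (expnS 2 e.+2); nia.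
have c_ge2 : (2 <= c)%N.
  have : (0 < 2 ^ e * (2 * i - 1))%N by rewrite muln_gt0 expn_gt0; lia.
  by rewrite def_c !expnS -!mulnA; lia.
have pow_dvd a b (x : int) : (a <= b)%N -> ((2 ^ a)%:Z %| 2 ^+ b * x)%Z.
  move=> le_ab; rewrite dvdz_mulr // -(subnK le_ab) exprD dvdz_mull //.
  by rewrite -natrX natz.
split.
- have [|a [b [eq_ab _]]] := overcubic_coef (N := 8 * n + 5) def_c c_ge2.
    by rewrite -modnDml modnMr.
  by rewrite def_k /abar -/(overcubic_trunc _ _) eq_ab rpredD ?pow_dvd //; lia.
- have [|a [b [eq_ab b2]]] := overcubic_coef (N := 8 * n + 7) def_c c_ge2.
    by rewrite -modnDml modnMr.
  have [|b' def_b] := dvdzP (b2 _); first by rewrite -modnDml modnMr.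
  (* The factor 2 of [b] raises 2^(k+1) to 2^(k+2), while the other term has 2^(2k) with 2k at least
     k + 2. *)
  rewrite def_k /abar -/(overcubic_trunc _ _) eq_ab def_b [b' * 2]mulrC mulrA -exprSr.
  by rewrite rpredD ?pow_dvd //; lia.
Qed.
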